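(* Let $\mathbb{U}=B^{\infty}([0,1],\mathbb{R}^{d})$, $\mathbb{V}=B^{1,\infty}([-1,1],\mathbb{R}^{d})$ and $\mathbb{A}=B^{1,\infty}([-1,0],\mathbb{R}^{d})$. Then the linear operator $\mathcal{G}:\mathbb{U}\times\mathbb{A}\to\mathbb{V}$ defined by $$\mathcal{G}(u,\psi)(t):=\begin{cases}\psi(0)+\displaystyle\int_{0}^{t}u(s)\,ds,&t\in[0,1],\\ \psi(t),&t\in[-1,0],\end{cases}$$ is bounded.
   Context: $d$ is a positive integer and $|\cdot|$ a norm on $\mathbb{R}^d$. Derivatives with respect to time are from the right. $B^{\infty}([a,b],\mathbb{R}^{d})$ is the Banach space of measurable bounded functions with norm $\|f\|_{\infty}=\sup|f|$; $B^{1,\infty}([a,b],\mathbb{R}^{d})$ is the Banach space of continuous functions with measurable and bounded first derivative, with norm $\|f\|_\infty+\|f'\|_\infty$. The derivative on $[0,1]$ of $\mathcal{G}(u,\psi)$ is identified with $u$. The product $\mathbb{U}\times\mathbb{A}$ carries the norm $\max\{\|u\|_{\mathbb{U}},\|\psi\|_{\mathbb{A}}\}$.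
   Formalization: For bounded measurable u the right derivative of the integral of u need not exist everywhere (e.g. u(s)=sin(log s) at 0), so elements of B^{1,∞} are taken as Lipschitz functions with a chosen bounded measurable derivative equal to the right derivative almost everywhere; for G(u,ψ) it is u on [0,1]. *)

(* Defs.v *)
From HB Require Import structures.
From mathcomp Require Import all_boot all_order all_algebra.
From mathcomp Require Import all_classical all_reals all_analysis.
From mathcomp Require Import measurable_realfun.

Set Implicit Arguments.
Unset Strict Implicit.
Unset Printing Implicit Defensive.

Import Order.TTheory GRing.Theory Num.Theory.
Import numFieldNormedType.Exports.

Local Open Scope classical_set_scope.
Local Open Scope ring_scope.

Record vnorm (R : realType) (d : nat) := VNorm {
  vnorm_fun :> 'rV[R]_d -> R;
  vnormD : forall x y, vnorm_fun (x + y) <= vnorm_fun x + vnorm_fun y;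
  vnormZ : forall (l : R) x, vnorm_fun (l *: x) = `|l| * vnorm_fun x;
  vnorm0_eq0 : forall x, vnorm_fun x = 0 -> x = 0 }.

(* R^d as a normed space for the given norm N, instead of the default sup norm
   of 'rV[R]_d: norm, topology, limits and continuity all refer to N. *)
Definition Rd (R : realType) (d : nat) (N : vnorm R d) : Type := 'rV[R]_d.

HB.instance Definition _ (R : realType) (d : nat) (N : vnorm R d) :=
  GRing.Lmodule.copy (Rd N) 'rV[R]_d.
HB.instance Definition _ (R : realType) (d : nat) (N : vnorm R d) :=
  Lmodule_isNormed.Build R (Rd N) (@vnormD R d N) (@vnormZ R d N)
    (@vnorm0_eq0 R d N).

(* The real line with its Lebesgue sigma-algebra (that of
   completed_lebesgue_measure) rather than the Borel one. *)
Definition lebesgueR (R : realType) : Type :=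
  caratheodory_type (mu_ext (@wlength R idfun)).
HB.instance Definition _ (R : realType) := Measurable.copy (lebesgueR R)
  (caratheodory_type (mu_ext (@wlength R idfun))).

Section sup_norm.
Context {R : realType} {V : normedModType R}.
Implicit Types (a b : R) (f g : R -> V).

Definition supnorm a b f : R := sup [set `|f t| | t in `[a, b]].

Definition supported a b f := forall t, t \notin `[a, b] -> f t = 0.

Definition bounded_on a b f := exists M : R, forall t, t \in `[a, b] -> `|f t| <= M.

Lemma supnorm_ge a b f t : bounded_on a b f -> t \in `[a, b] ->
  `|f t| <= supnorm a b f.
Proof.
move=> [M fM] abt; apply: ub_le_sup; last by exists t.
by exists M => _ [s /fM sM <-].
Qed.

Lemma supnorm_le a b f (M : R) : 0 <= M ->
  (forall t, t \in `[a, b] -> `|f t| <= M) -> supnorm a b f <= M.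
Proof.
move=> M0 fM; rewrite /supnorm.
have [->|/set0P S0] := eqVneq [set `|f t| | t in `[a, b]] set0.
  by rewrite sup0.
by apply: ge_sup => // _ [t /fM tM <-].
Qed.

Lemma supnorm_ge0 a b f : 0 <= supnorm a b f.
Proof.
rewrite /supnorm; set A := [set _ | _ in _].
have [[[x [t abt tx]] [M fM]]|supA] := pselect (has_sup A).
  by rewrite (le_trans (normr_ge0 (f t)))// tx ub_le_sup//; [exists M|exists t].
by rewrite sup_out.
Qed.

Lemma supnormD a b f g : bounded_on a b f -> bounded_on a b g ->
  supnorm a b (f + g) <= supnorm a b f + supnorm a b g.
Proof.
move=> bf bg; apply: supnorm_le => [|t abt].
  by rewrite addr_ge0 ?supnorm_ge0.
by rewrite (le_trans (ler_normD _ _))// lerD// supnorm_ge.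
Qed.

Lemma bounded_onZ a b (l : R) f : bounded_on a b f -> bounded_on a b (l *: f).
Proof.
by move=> [M fM]; exists (`|l| * M) => t /fM tM; rewrite normrZ ler_wpM2l.
Qed.

Lemma supnormZ a b (l : R) f : bounded_on a b f ->
  supnorm a b (l *: f) = `|l| * supnorm a b f.
Proof.
move=> bf; apply/eqP; rewrite eq_le; apply/andP; split.
  apply: supnorm_le => [|t abt]; first by rewrite mulr_ge0 ?supnorm_ge0.
  by rewrite normrZ ler_wpM2l// supnorm_ge.
have [->|l0] := eqVneq l 0.
  by rewrite normr0 mul0r supnorm_ge0.
rewrite -ler_pdivlMl ?normr_gt0//; apply: supnorm_le => [|t abt].
  by rewrite mulr_ge0 ?supnorm_ge0// invr_ge0.
rewrite ler_pdivlMl ?normr_gt0// -normrZ.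
by apply: (@supnorm_ge a b (l *: f)) => //; exact: bounded_onZ.
Qed.

Lemma supnorm0_eq0 a b f : bounded_on a b f -> supported a b f ->
  supnorm a b f = 0 -> f = 0.
Proof.
move=> bf sf f0; apply/funext => t; have [abt|/sf//] := boolP (t \in `[a, b]).
by apply/eqP; rewrite -normr_eq0 eq_le normr_ge0 andbT -f0 supnorm_ge.
Qed.

End sup_norm.

Section spaces.
Context {R : realType} {d : nat} (N : vnorm R d).
Implicit Types (a b : R) (f g : R -> Rd N).

Definition lebesgue_measurable_on a b f := forall i : 'I_d,
  measurable_fun (`[a, b] : set (lebesgueR R))
    (fun t : lebesgueR R => (f t : 'rV[R]_d) 0 i).

(* A function on [a, b] is represented by its extension by 0 to the line. *)
Definition is_Binf a b f :=
  [/\ supported a b f, lebesgue_measurable_on a b f & bounded_on a b f].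

Definition has_right_deriv f (t : R) (v : Rd N) :=
  h^-1 *: (f (t + h) - f t) @[h --> 0^'+] --> v.

(* An element of B^{1,oo} is a continuous function p.1 together with a chosen
   bounded measurable derivative p.2. The latter is only required to be the right
   derivative of p.1 almost everywhere, because the space has to contain
   t |-> \int_0^t u(s)ds, with derivative u, for every bounded measurable u.
   The Lipschitz condition ties p.1 to p.2 (it excludes, e.g., the Cantor function
   with derivative 0). It is automatic when p.2 is the right derivative of p.1
   everywhere on [a, b[, by the mean value inequality. *)
Definition is_B1inf a b (p : (R -> Rd N) * (R -> Rd N)) :=
  [/\ supported a b p.1, {within `[a, b], continuous p.1}, is_Binf a b p.2,
      {ae @completed_lebesgue_measure R, forall t,
         t \in `[a, b[ -> has_right_deriv p.1 t (p.2 t)} &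
      exists L : R, forall s t, s \in `[a, b] -> t \in `[a, b] ->
        `|p.1 t - p.1 s| <= L * `|t - s|].

Lemma is_Binf0 a b : is_Binf a b 0.
Proof.
split=> //; last by exists 0 => t _; rewrite normr0.
Qed.

Lemma is_Binf_lin a b (l : R) f g : is_Binf a b f -> is_Binf a b g ->
  is_Binf a b (l *: f + g).
Proof.
move=> [sf mf [M fM]] [sg mg [K gK]]; split.
- move=> t nt; rewrite -[LHS]/(l *: f t + g t) sf// sg//.
  by rewrite scaler0 addr0.
- move=> i.
  rewrite (_ : (fun _ => _) =
    (fun t : lebesgueR R => l * (f t : 'rV[R]_d) 0 i + (g t : 'rV[R]_d) 0 i)).
    apply: measurable_funD; last exact: mg.
    by apply: measurable_funM; [exact: measurable_cst|exact: mf].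
  by apply/funext => t; rewrite !mxE.
- exists (`|l| * M + K) => t abt.
  rewrite (le_trans (ler_normD _ _))// lerD ?gK// normrZ ler_wpM2l//.
  exact: fM.
Qed.

Lemma is_B1inf0 a b : is_B1inf a b 0.
Proof.
split=> //.
- by move=> t; exact: cvg_cst.
- exact: is_Binf0.
- apply: aeW => t _; rewrite /has_right_deriv /=.
  rewrite (_ : (fun _ => _) = cst 0); first exact: cvg_cst.
  by apply/funext => h; rewrite subrr scaler0.
- by exists 0 => s t _ _; rewrite /= subrr normr0 mul0r.
Qed.

Lemma is_B1inf_lin a b (l : R) p q : is_B1inf a b p -> is_B1inf a b q ->
  is_B1inf a b (l *: p + q).
Proof.
move=> [sp cp bp dp [L pL]] [sq cq bq dq [K qK]]; split.
- move=> t nt; rewrite -[LHS]/(l *: p.1 t + q.1 t) sp// sq//.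
  by rewrite scaler0 addr0.
- by move=> t; exact: (cvgD (cvgZl_tmp (cp t)) (cq t)).
- exact: is_Binf_lin.
- have aeF := ae_filter_ringOfSetsType (@completed_lebesgue_measure R).
  apply: filterS2 dp dq => t pt qt abt; rewrite /has_right_deriv /=.
  rewrite (_ : (fun _ => _) = (fun h => l *: (h^-1 *: (p.1 (t + h) - p.1 t))
      + h^-1 *: (q.1 (t + h) - q.1 t))).
    by apply: cvgD; [apply: cvgZl_tmp; exact: pt|exact: qt].
  apply/funext => h.
  rewrite -![((_ : R -> Rd N) + _) _]/(_ + _).
  rewrite opprD addrACA scalerDr -scalerBr !scalerA; congr (_ + _).
  by rewrite mulrC.
- exists (`|l| * L + K) => s t abs abt; rewrite mulrDl.
  rewrite -[p in `|p|]/(l *: p.1 t + q.1 t - (l *: p.1 s + q.1 s)).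
  rewrite opprD addrACA -scalerBr (le_trans (ler_normD _ _))// lerD ?qK//.
  by rewrite normrZ -mulrA ler_wpM2l// pL.
Qed.

Definition Binf_pred a b : {pred R -> Rd N} := fun f => `[< is_Binf a b f >].
Definition B1inf_pred a b : {pred (R -> Rd N) * (R -> Rd N)} :=
  fun p => `[< is_B1inf a b p >].

Lemma Binf_submod_closed a b : submod_closed (Binf_pred a b).
Proof.
split=> [|l f g /asboolP Bf /asboolP Bg]; first exact/asboolP/is_Binf0.
exact/asboolP/is_Binf_lin.
Qed.

Lemma B1inf_submod_closed a b : submod_closed (B1inf_pred a b).
Proof.
split=> [|l f g /asboolP Bf /asboolP Bg]; first exact/asboolP/is_B1inf0.
exact/asboolP/is_B1inf_lin.
Qed.

HB.instance Definition _ a b := GRing.isSubmodClosed.Build R _ (Binf_pred a b)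
  (Binf_submod_closed a b).
HB.instance Definition _ a b := GRing.isSubmodClosed.Build R _ (B1inf_pred a b)
  (B1inf_submod_closed a b).

Record Binf a b := MkBinf {
  Binf_fun :> R -> Rd N;
  Binf_funP : Binf_fun \in Binf_pred a b }.

Record B1inf a b := MkB1inf {
  B1inf_pair : (R -> Rd N) * (R -> Rd N);
  B1inf_pairP : B1inf_pair \in B1inf_pred a b }.

Definition B1inf_fun a b (f : B1inf a b) : R -> Rd N := (B1inf_pair f).1.
Definition B1inf_deriv a b (f : B1inf a b) : R -> Rd N := (B1inf_pair f).2.

End spaces.

Coercion B1inf_fun : B1inf >-> Funclass.

Section normed_spaces.
Context {R : realType} {d : nat} (N : vnorm R d) (a b : R).

HB.instance Definition _ := [isSub for @Binf_fun R d N a b].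
HB.instance Definition _ := [Choice of Binf N a b by <:].
HB.instance Definition _ := [SubChoice_isSubLmodule of Binf N a b by <:].

HB.instance Definition _ := [isSub for @B1inf_pair R d N a b].
HB.instance Definition _ := [Choice of B1inf N a b by <:].
HB.instance Definition _ := [SubChoice_isSubLmodule of B1inf N a b by <:].

Definition Binf_norm (f : Binf N a b) : R := supnorm a b f.

Definition B1inf_norm (f : B1inf N a b) : R :=
  supnorm a b f + supnorm a b (B1inf_deriv f).

Lemma BinfP (f : Binf N a b) : is_Binf a b f.
Proof. exact/asboolP/(Binf_funP f). Qed.

Lemma B1infP (f : B1inf N a b) : is_B1inf a b (B1inf_pair f).
Proof. exact/asboolP/(B1inf_pairP f). Qed.

Lemma Binf_bounded (f : Binf N a b) : bounded_on a b f.
Proof. by have [] := BinfP f. Qed.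

Lemma B1inf_deriv_bounded (f : B1inf N a b) : bounded_on a b (B1inf_deriv f).
Proof. by have [_ _ []] := B1infP f. Qed.

Lemma B1inf_bounded (f : B1inf N a b) : bounded_on a b f.
Proof.
have [_ _ _ _ [L fL]] := B1infP f.
exists (`|L| * `|b - a| + `|f a|) => t abt.
have [at_ tb] : a <= t /\ t <= b by move: abt; rewrite /= in_itv/= => /andP.
rewrite -[f t](subrK (f a)) (le_trans (ler_normD _ _))// lerD2r.
have /fL/(_ abt)/le_trans -> // : a \in `[a, b].
  by rewrite /= in_itv/= lexx (le_trans at_).
rewrite (@le_trans _ _ (`|L| * `|t - a|))// ?ler_wpM2r ?ler_norm//.
rewrite ler_wpM2l// [leLHS]ger0_norm ?subr_ge0// ger0_norm ?lerB//.
by rewrite subr_ge0 (le_trans at_).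
Qed.

Lemma Binf_normD (f g : Binf N a b) :
  Binf_norm (f + g) <= Binf_norm f + Binf_norm g.
Proof. by apply: supnormD; exact: Binf_bounded. Qed.

Lemma Binf_normZ (l : R) (f : Binf N a b) :
  Binf_norm (l *: f) = `|l| * Binf_norm f.
Proof. by apply: supnormZ; exact: Binf_bounded. Qed.

Lemma Binf_norm0_eq0 (f : Binf N a b) : Binf_norm f = 0 -> f = 0.
Proof.
move=> f0; apply/val_inj/(supnorm0_eq0 (Binf_bounded f)) => //.
by have [] := BinfP f.
Qed.

HB.instance Definition _ := Lmodule_isNormed.Build R (Binf N a b)
  Binf_normD Binf_normZ Binf_norm0_eq0.

Lemma B1inf_normD (f g : B1inf N a b) :
  B1inf_norm (f + g) <= B1inf_norm f + B1inf_norm g.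
Proof.
rewrite /B1inf_norm addrACA lerD//; apply: supnormD;
  by [exact: B1inf_bounded|exact: B1inf_deriv_bounded].
Qed.

Lemma B1inf_normZ (l : R) (f : B1inf N a b) :
  B1inf_norm (l *: f) = `|l| * B1inf_norm f.
Proof.
rewrite /B1inf_norm mulrDr; congr (_ + _); apply: supnormZ;
  by [exact: B1inf_bounded|exact: B1inf_deriv_bounded].
Qed.

Lemma B1inf_norm0_eq0 (f : B1inf N a b) : B1inf_norm f = 0 -> f = 0.
Proof.
move=> /eqP; rewrite paddr_eq0 ?supnorm_ge0// => /andP[/eqP f0 /eqP f'0].
have [sf _ [sf' _ _] _ _] := B1infP f.
apply/val_inj => /=; rewrite [LHS]surjective_pairing.
by congr pair; [exact: (supnorm0_eq0 (B1inf_bounded f))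
  |exact: (supnorm0_eq0 (B1inf_deriv_bounded f))].
Qed.

HB.instance Definition _ := Lmodule_isNormed.Build R (B1inf N a b)
  B1inf_normD B1inf_normZ B1inf_norm0_eq0.

End normed_spaces.

Definition vintegral (R : realType) (d : nat) (N : vnorm R d) (a b : R)
    (u : R -> Rd N) : Rd N :=
  \row_(i < d) \int[@completed_lebesgue_measure R]_(s in `[a, b])
    (u s : 'rV[R]_d) 0 i.

Definition bounded_operator (R : realType) (V W : normedModType R)
    (T : {linear V -> W}) :=
  exists C : R, forall x : V, `|T x| <= C * `|x|.

(* Main.v *)
(* The derivative of G(u, psi) is u on [0, 1] and psi' on [-1, 0[, so the only
   analytic content is that t |-> \int_0^t u is a Lipschitz function with right
   derivative u almost everywhere. A bounded Lebesgue measurable function agrees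
   almost everywhere with a bounded Borel function, to which the Lebesgue
   differentiation theorem applies; equivalence of norms on R^d allows one to
   argue coordinatewise. *)
From HB Require Import structures.
Require Import Defs.
From mathcomp Require Import all_boot all_order all_algebra.
From mathcomp Require Import all_classical all_reals all_analysis.
From mathcomp Require Import measurable_realfun.
From mathcomp Require Import ring lra.

Set Implicit Arguments.
Unset Strict Implicit.
Unset Printing Implicit Defensive.

Import Order.TTheory GRing.Theory Num.Theory.
Import numFieldNormedType.Exports.

Local Open Scope classical_set_scope.
Local Open Scope ring_scope.

(** * Comparison of Lebesgue measurable and Borel data *)

Definition borel_id (R : realType) : lebesgueR R -> measurableTypeR R := id.

Section completed.
Context {R : realType}.
Local Notation lam := (@lebesgue_measure R).
Local Notation mu := (@completed_lebesgue_measure R).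

Lemma borel_lebesgue (A : set R) :
  measurable A -> measurable (A : set (lebesgueR R)).
Proof. exact: sub_caratheodory. Qed.

Lemma negligible_completed (A : set R) : lam.-negligible A -> mu.-negligible A.
Proof.
by move=> [B [mB B0 AB]]; exists B; split => //; exact: sub_caratheodory.
Qed.

(** The Caratheodory sigma-algebra is the completion of the Borel one, so [A] is a Borel set [B]
    united with a negligible set, and the two differ only inside the latter. *)
Lemma lebesgue_borel_ae (A : set R) : measurable (A : set (lebesgueR R)) ->
  exists2 B : set R, measurable B & {ae mu, forall t, A t <-> B t}.
Proof.
rewrite /measurable/= => mA.
have : completed_algebra_gen lam A.
  by rewrite -g_sigma_completed_algebra_genE completed_caratheodory_measurable.
move=> [B mB [N nN ABN]]; exists B => //.
apply/negligible_completed/negligibleS/nN => t /=; rewrite -ABN.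
apply: contra_notP => nNt; by split => [[Bt|/nNt]|Bt] //; left.
Qed.

Lemma measurable_borel_id : measurable_fun setT (@borel_id R).
Proof. by move=> _ B mB; rewrite setTI; exact: borel_lebesgue. Qed.

HB.instance Definition _ :=
  isMeasurableFun.Build _ _ _ _ (@borel_id R) measurable_borel_id.

(** Change of variables along [borel_id]: the completed measure, pushed forward to the Borel sets,
    is the Lebesgue measure. *)
Lemma Rintegral_completed (D : set R) (f : R -> R) : measurable D ->
  measurable_fun setT f ->
  mu.-integrable D (EFin \o f) ->
  \int[mu]_(t in D) f t = \int[lam]_(t in D) f t.
Proof.
move=> mD mf intf; rewrite /Rintegral; congr fine.
have mEf : measurable_fun setT (EFin \o f) by exact/measurable_EFinP.
have := integral_pushforward measurable_borel_id mEf intf mD.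
rewrite preimage_id /= => <-.
apply: eq_measure_integral => A mA _.
by rewrite /= /pushforward preimage_id.
Qed.

(* f is the supremum of the rationals below it: each level set {q < f} is
   replaced by a Borel set, and the values are truncated to [-M, M]. *)
Lemma lebesgue_fun_borel_ae (D : set R) (f : R -> R) (M : R) :
  0 <= M -> measurable D ->
  measurable_fun (D : set (lebesgueR R)) (f : lebesgueR R -> R) ->
  (forall t, D t -> `|f t| <= M) ->
  exists g : R -> R, [/\ measurable_fun setT g, forall t, `|g t| <= M &
    {ae mu, forall t, D t -> f t = g t}].
Proof.
move=> M0 mD mf fM.
(* This sequence runs through all rationals; codes of no rational default to 0. *)
pose q n : R := ratr (odflt 0 (unpickle n) : rat).
have mDf n : measurable (D `&` f @^-1` `]q n, +oo[ : set (lebesgueR R)).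
  by apply: mf; [exact: borel_lebesgue|exact: measurable_itv].
pose B n := s2val (cid2 (lebesgue_borel_ae (mDf n))).
have mB n : measurable (B n) := s2valP (cid2 (lebesgue_borel_ae (mDf n))).
have aeB n : {ae mu, forall t, (D `&` f @^-1` `]q n, +oo[) t <-> B n t} :=
  s2valP' (cid2 (lebesgue_borel_ae (mDf n))).
(* With this choice [h n] equals [q n] on [B n] and [- M] off it when [q n] lies in [-M, M].
   Otherwise it is constantly [- M] and does not affect the supremum. *)
pose c n := if `|q n| <= M then q n + M else 0.
pose h n t := - M + c n * \1_(B n) t.
have hM n t : - M <= h n t <= M.
  rewrite /h /c indicE; case: ifPn => [|_]; rewrite ?ler_norml; last by lra.
  by case: (t \in B n) => /=; lra.
have h_ub t : has_ubound (range (h ^~ t)).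
  by exists M => _ [n _ <-]; case/andP: (hM n t).
have h_le n t : h n t <= sups (h ^~ t) 0.
  by apply: ub_le_sup; [exact: has_ubound_sdrop|exists n].
exists (fun t => sups (h ^~ t) 0); split.
- apply: measurable_fun_sups => // n.
  apply: measurable_funD => //; exact: measurable_funM.
- move=> t; rewrite ler_norml (le_trans _ (h_le 0 t)).
    by apply: ge_sup => [|_ [n _ <-]]; [exists (h 0 t), 0|case/andP: (hM n t)].
  by case/andP: (hM 0 t).
- have aeF := ae_filter_ringOfSetsType mu.
  apply: filterS (ae_foralln aeB) => t BP Dt.
  have /andP[Mft ftM] : - M <= f t <= M by rewrite -ler_norml fM.
  apply/eqP; rewrite eq_le; apply/andP; split; last first.
    apply: ge_sup => [|_ [n _ <-]]; first by exists (h 0 t), 0.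
    rewrite /h /c indicE; have [/set_mem/BP[_ /=]|_] := boolP (t \in B n).
      by rewrite in_itv/= andbT; case: ifPn => _ /=; lra.
    by case: ifPn => _ /=; lra.
  (* A rational strictly between the supremum and [f t] would lie in [-M, M] and be one of the
     values [h n t], hence at most the supremum. *)
  rewrite leNgt; apply/negP => /rat_in_itvoo[r].
  rewrite in_itv/= => /andP[gr rf].
  have qr : q (pickle r) = ratr r by rewrite /q pickleK.
  have := h_le (pickle r) t; apply/negP; rewrite -ltNge (lt_le_trans gr)//.
  rewrite /h /c indicE mem_set; last first.
    by apply/BP; split => //=; rewrite qr in_itv/= rf.
  have := h_le 0 t; have /andP[+ _] := hM 0 t.
  by rewrite qr ler_norml; case: ifPn => /=; lra.
Qed.

End completed.

(** * Primitives of bounded Lebesgue measurable real functions *)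

Section bounded_primitive.
Context {R : realType}.
Local Notation lam := (@lebesgue_measure R).
Local Notation mu := (@completed_lebesgue_measure R).

Lemma bounded_integrable_itv (g : R -> R) M c d : measurable_fun setT g ->
  (forall t, `|g t| <= M) -> lam.-integrable `[c, d] (EFin \o g).
Proof.
move=> mg gM; apply: measurable_bounded_integrable => //.
- exact/compact_finite_measure/segment_compact.
- exact: measurable_funTS.
- exists M; split; first exact: num_real.
  by move=> x Mx t _ /=; rewrite (le_trans (gM t))// ltW.
Qed.

Lemma bounded_lebesgue_integrable_itv (f : R -> R) M c d :
  measurable_fun (`[c, d] : set (lebesgueR R)) (f : lebesgueR R -> R) ->
  (forall t, t \in `[c, d] -> `|f t| <= M) ->
  mu.-integrable `[c, d] (EFin \o f).
Proof.
move=> mf fM; apply: measurable_bounded_integrable => //.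
- exact: borel_lebesgue.
- exact: compact_finite_measure (@segment_compact _ c d).
- exists M; split; first exact: num_real.
  by move=> x Mx t cdt /=; rewrite (le_trans (fM t cdt))// ltW.
Qed.

Variables (a b M : R) (f : R -> R).
Hypothesis mf :
  measurable_fun (`[a, b] : set (lebesgueR R)) (f : lebesgueR R -> R).
Hypothesis fM : forall t, t \in `[a, b] -> `|f t| <= M.

Lemma lebesgue_integrable_itv t : t \in `[a, b] ->
  mu.-integrable `[a, t] (EFin \o f).
Proof.
rewrite in_itv/= => /andP[at_ tb].
have sub : `[a, t] `<=` `[a, b] by apply: subset_itvl; rewrite bnd_simp.
apply: (@bounded_lebesgue_integrable_itv _ M) => [|s /sub]; last exact: fM.
by apply: measurable_funS mf => //; exact: borel_lebesgue.
Qed.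

(** Transfers questions about the primitive of [f] to a Borel function [g] with the same bound:
    changing [f] on a null set preserves its integrals, and for Borel integrands the completed and
    the ordinary Lebesgue integral agree. *)
Lemma lebesgue_primitive_borel : 0 <= M ->
  exists g : R -> R, [/\ measurable_fun setT g, forall t, `|g t| <= M,
    {ae mu, forall t, t \in `[a, b] -> f t = g t} &
    forall t, t \in `[a, b] ->
      \int[mu]_(s in `[a, t]) f s = \int[lam]_(s in `[a, t]) g s].
Proof.
move=> M0.
have fM' t : `[a, b]%classic t -> `|f t| <= M by exact: fM.
have [g [mg gM fg]] := lebesgue_fun_borel_ae M0 (measurable_itv _) mf fM'.
exists g; split => // t abt.
have sub : `[a, t] `<=` `[a, b].
  apply: subset_itvl; rewrite bnd_simp.
  by move: abt; rewrite in_itv/= => /andP[].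
have mat : measurable (`[a, t] : set (lebesgueR R)) by exact: borel_lebesgue.
have mg' : measurable_fun (`[a, t] : set (lebesgueR R)) (EFin \o g).
  apply/measurable_EFinP => _ B mB; apply: borel_lebesgue.
  by apply: (measurable_funTS mg).
have intf := lebesgue_integrable_itv abt.
have ae_fg : ae_eq mu `[a, t]%classic (EFin \o f) (EFin \o g).
  have aeF := ae_filter_ringOfSetsType mu.
  by apply: filterS fg => s fgs /sub /fgs /= ->.
rewrite -Rintegral_completed//.
  rewrite /Rintegral; congr fine; apply: ae_eq_integral => //.
  by case/integrableP: intf.
by apply: (@bounded_lebesgue_integrable_itv _ M) => //; exact/measurable_EFinP.
Qed.

Lemma lebesgue_primitive0 : 0 <= M -> a <= b ->
  \int[mu]_(s in `[a, a]) f s = 0.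
Proof.
move=> M0 ab; have [g [_ _ _ ->]] := lebesgue_primitive_borel M0.
  by rewrite set_itv1 Rintegral_set1.
by rewrite in_itv/= lexx.
Qed.

(** For [s <= t] the difference is the integral over []s, t]] of the Borel representative, whose
    absolute value is at most [M]. *)
Lemma lebesgue_primitive_lip s t : 0 <= M -> s \in `[a, b] -> t \in `[a, b] ->
  `|\int[mu]_(x in `[a, t]) f x - \int[mu]_(x in `[a, s]) f x| <= M * `|t - s|.
Proof.
move=> M0; wlog st : s t / s <= t.
  move=> H sab tab; have [st|/ltW ts] := leP s t; first exact: H.
  by rewrite distrC [leRHS](_ : _ = M * `|s - t|) ?H// distrC.
move=> sab tab; have [g [mg gM _ int_eq]] := lebesgue_primitive_borel M0.
move: (sab) (tab); rewrite !in_itv/= => /andP[as_ sb] /andP[at_ tb].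
have intg := bounded_integrable_itv a t mg gM.
rewrite !int_eq// Rintegral_itvB ?bnd_simp//.
have sub : `]s, t] `<=` `[a, t] by apply: subset_itvr; rewrite bnd_simp.
have intg' : lam.-integrable `]s, t] (EFin \o g) by exact: integrableS intg.
rewrite (le_trans (le_normr_Rintegral _ intg'))//.
have -> : M * `|t - s| = \int[lam]_(x in `]s, t]) M.
  rewrite Rintegral_cst//= lebesgue_measure_itv/= lte_fin ger0_norm ?subr_ge0//.
  by case: ltgtP st => // -> _; rewrite subrr.
apply: le_Rintegral => //.
- exact: (integrable_norm intg').
- apply: measurable_bounded_integrable => //.
    rewrite /= lebesgue_measure_itv/=.
    by case: ifP => // _; rewrite -EFinB ltry.
  exists M; split; first exact: num_real.
  by move=> x Mx r _ /=; rewrite ger0_norm// ltW.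
Qed.

(** The first fundamental theorem of calculus is applied to the Borel representative [g]. The
    exceptional null set collects the points where [f] and [g] differ, those where differentiation
    fails, and the endpoint [a]. *)
Lemma lebesgue_primitive_deriv_ae : 0 <= M -> {ae mu, forall t, t \in `[a, b[ ->
  h^-1 * (\int[mu]_(s in `[a, t + h]) f s - \int[mu]_(s in `[a, t]) f s)
    @[h --> 0^'+] --> f t}.
Proof.
move=> M0; have [g [mg gM fg int_eq]] := lebesgue_primitive_borel M0.
have lg : locally_integrable setT g.
  split => //; first exact: openT.
  move=> K _ cK.
  have : lam.-integrable K (EFin \o g).
    apply: measurable_bounded_integrable.
    - exact: compact_measurable.
    - exact: compact_finite_measure.
    - exact: measurable_funTS.
    - exists M; split; first exact: num_real.
      by move=> x Mx t _ /=; rewrite (le_trans (gM t))// ltW.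
  by case/integrableP.
have := @FTC1 _ g (BLeft a) (fun y => bounded_integrable_itv a y mg gM) lg.
move=> /negligible_completed dG.
have aeF := ae_filter_ringOfSetsType mu.
(* The differentiation theorem only speaks of points strictly to the right of [a]. *)
have na : {ae mu, forall t, t != a}.
  exists [set a]; split; [exact: borel_lebesgue|exact: lebesgue_measure_set1|].
  by move=> t /= /negP; rewrite negbK => /eqP.
apply: filterS3 fg dG na => t fgt dGt tNa /[dup] tab.
rewrite in_itv/= => /andP[at_ tb].
have tab' : t \in `[a, b] by rewrite in_itv/= at_ ltW.
have [|dF gt] := dGt; first by rewrite lte_fin lt_neqAle eq_sym tNa.
rewrite fgt// -gt derive1E.
have /cvg_dnbhs_at_right := dF; rewrite -/(derive _ _ _).
apply: cvg_trans; apply: near_eq_cvg; near=> h.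
have h0 : 0 < h by near: h; exact: nbhs_right_gt.
(* Since [t < b], small increments stay in [[a, b]], where the primitives of [f] and [g]
   coincide. *)
have thb : t + h <= b.
  by rewrite -lerBrDl; near: h; apply: nbhs_right_le; rewrite subr_gt0.
rewrite !int_eq//; last first.
  by rewrite in_itv/= thb andbT (le_trans at_)// lerDl ltW.
by rewrite /= [h%:A]mulr1 [h + t]addrC.
Unshelve. all: by end_near. Qed.


End bounded_primitive.

(** * Equivalence of the given norm with the sup norm *)

Section vnorm_equivalence.
Context {R : realType} {d : nat} (N : vnorm R d).
Implicit Types x y : 'rV[R]_d.

Lemma coord_le_mxnorm x i : `|x 0 i| <= `|x|.
Proof.
by rewrite [leRHS]mx_normE -[leLHS]nngE num_le; exact: (le_bigmax _ _ (0, i)).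
Qed.

Lemma vnorm_eq0 : N 0 = 0.
Proof. by rewrite -(scale0r (0 : 'rV[R]_d)) vnormZ normr0 mul0r. Qed.

Lemma vnorm_ge0 x : 0 <= N x.
Proof. exact: (@normr_ge0 _ (Rd N) x). Qed.

Lemma vnorm_coord x : N x <= \sum_(i < d) `|x 0 i| * N 'e_i.
Proof.
rewrite {1}(row_sum_delta x).
elim/big_ind2 : _ => [|u r v s ur vs|i _]; first by rewrite vnorm_eq0.
  by rewrite (le_trans (vnormD _ _ _))// lerD.
by rewrite vnormZ.
Qed.

Lemma vnorm_le_mxnorm x : N x <= `|x| * \sum_(i < d) N 'e_i.
Proof.
rewrite (le_trans (vnorm_coord x))// mulr_sumr; apply: ler_sum => i _.
by rewrite ler_wpM2r ?vnorm_ge0//; exact: coord_le_mxnorm.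
Qed.

(** Continuity here is for the sup-norm topology; it follows from [|N x - N y| <= N (x - y)] and the
    upper bound of [N] by the sup norm. *)
Lemma vnorm_continuous : continuous (N : 'rV[R]_d -> R).
Proof.
move=> x; have FF : ProperFilter (nbhs x).
  exact: (@nbhs_pfilter ('rV[R]_d : normedModType R) x).
apply/(@cvgrPdist_le _ _ _ (nbhs x)) => e e0.
(* The summand 1 makes [C] positive, so that dividing by it is allowed. *)
pose C := 1 + \sum_(i < d) N 'e_i.
have C0 : 0 < C by rewrite ltr_pwDl// sumr_ge0// => i _; exact: vnorm_ge0.
near=> y.
have H : `|N x - N y| <= N (x - y).
  exact: (@ler_dist_dist _ (Rd N) x y).
rewrite (le_trans H)// (le_trans (vnorm_le_mxnorm _))//.
rewrite (@le_trans _ _ (`|x - y| * C))// ?ler_wpM2l// ?lerDr//.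
rewrite -ler_pdivlMr//; near: y; apply: cvgr_dist_le => //.
by rewrite divr_gt0.
Unshelve. all: by end_near. Qed.

(** On the compact unit sphere of the sup norm, [N] attains a minimum, which is positive because [N]
    vanishes only at 0. Homogeneity extends the bound to all vectors, with the inverse of the
    minimum as constant. *)
Lemma mxnorm_le_vnorm : exists2 K : R, 0 <= K & forall x, `|x| <= K * N x.
Proof.
pose S := [set x : 'rV[R]_d | `|x| = 1].
(* An empty sphere, as in dimension 0, forces every vector to be 0. *)
have [S0|/set0P Sn0] := eqVneq S set0.
  exists 0 => // x; rewrite mul0r normr_le0; apply/negPn/negP => x0.
  suff : S (`|x|^-1 *: x) by rewrite S0.
  by rewrite /S /= normrZ normfV normr_id mulVf// normr_eq0.
have cS : compact S.
  apply: bounded_closed_compact.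
    exists 1; split; first exact: num_real.
    by move=> r r1 x /= ->; exact: ltW.
  rewrite (_ : S = Num.norm @^-1` [set 1])//.
  apply: closed_comp; last exact: closed_eq.
  by move=> x _; exact: norm_continuous.
have [|c Sc cmin] := EVT_min_rV Sn0 cS (f := N).
  exact: continuous_subspaceT vnorm_continuous.
have Nc0 : 0 < N c.
  rewrite lt_neqAle vnorm_ge0 andbT eq_sym; apply/eqP => /vnorm0_eq0 c0.
  by move: Sc; rewrite inE /S /= c0 normr0 => /eqP; rewrite eq_sym oner_eq0.
exists (N c)^-1; first by rewrite invr_ge0 ltW.
move=> x; have [->|x0] := eqVneq x 0.
  by rewrite normr0 mulr_ge0 ?vnorm_ge0// invr_ge0 ltW.
have nx0 : 0 < `|x| by rewrite normr_gt0.
rewrite mulrC ler_pdivlMr// mulrC -ler_pdivlMr// mulrC.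
have -> : `|x|^-1 * N x = N (`|x|^-1 *: x) by rewrite vnormZ normfV normr_id.
apply: cmin; rewrite inE /S /= normrZ normfV normr_id mulVf//.
by rewrite gt_eqF.
Qed.

Lemma coord_le_vnorm : exists2 K : R, 0 <= K & forall x i, `|x 0 i| <= K * N x.
Proof.
have [K K0 xK] := mxnorm_le_vnorm; exists K => // x i.
by rewrite (le_trans _ (xK x))//; exact: coord_le_mxnorm.
Qed.

(** The distance for [N] is at most the sum of the coordinate errors weighted by the norms of the
    basis vectors, and this finite sum tends to 0. *)
Lemma Rd_cvg_coord (T : Type) (F : set_system T) (FF : Filter F)
    (f : T -> Rd N) (v : Rd N) :
  (forall i, (f t : 'rV[R]_d) 0 i @[t --> F] --> (v : 'rV[R]_d) 0 i) ->
  f t @[t --> F] --> v.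
Proof.
move=> fv.
have /cvgrPdist_lt S0 : \sum_(i < d)
    `|(v : 'rV[R]_d) 0 i - (f t : 'rV[R]_d) 0 i| * N 'e_i
    @[t --> F] --> (0 : R).
  rewrite -[X in _ --> X](@big1 R 0 +%R 'I_d (index_enum _) xpredT (fun=> 0))//.
  apply: cvg_big => [|i _]; first exact: add_continuous.
  rewrite -[X in _ --> X](mul0r (N 'e_i)).
  apply: cvgMr_tmp; rewrite -[X in _ --> X](@normr0 R R); apply: cvg_norm.
  rewrite -[X in _ --> X](subrr ((v : 'rV[R]_d) 0 i)).
  by apply: cvgB => //; exact: cvg_cst.
apply/cvgrPdist_lt => e /S0; apply: filterS => t; rewrite sub0r normrN.
move=> /(le_lt_trans (ler_norm _)); apply: le_lt_trans.
rewrite (le_trans (vnorm_coord _))//.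
by apply: ler_sum => i _; rewrite !mxE.
Qed.

End vnorm_equivalence.

(** * Lipschitz functions on intervals *)

Section lipschitz.
Context {R : realType} {V : normedModType R}.
Implicit Types (f : R -> V) (a b c : R).

Definition lipschitz_itv a b (L : R) f := forall s t,
  s \in `[a, b] -> t \in `[a, b] -> `|f t - f s| <= L * `|t - s|.

Lemma lipschitz_itv_continuous a b L f : lipschitz_itv a b L f ->
  {within `[a, b], continuous f}.
Proof.
move=> fL; apply/subspace_continuousP => t abt; apply/cvgrPdist_le => e e0.
have L0 : 0 < `|L| + 1 by rewrite ltr_wpDl.
have near_t : \forall s \near t, `|t - s| <= e / (`|L| + 1).
  apply/nbhs_ballP; exists (e / (`|L| + 1)) => [|s /ltW] //=.
  by rewrite divr_gt0.
near=> s.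
have abs : s \in `[a, b] by near: s; exact: withinT.
rewrite (le_trans (fL s t abs abt))//.
rewrite (@le_trans _ _ ((`|L| + 1) * `|t - s|))//.
  by rewrite ler_wpM2r// (le_trans (ler_norm L))// lerDl.
rewrite mulrC -ler_pdivlMr//; near: s; exact: cvg_within near_t.
Unshelve. all: by end_near. Qed.

(** Only a pair of points on either side of [b] needs an argument: the triangle inequality through
    [f b]. *)
Lemma lipschitz_itv_glue a b c L K f : 0 <= L -> 0 <= K ->
  lipschitz_itv a b L f -> lipschitz_itv b c K f ->
  lipschitz_itv a c (L + K) f.
Proof.
move=> L0 K0 fL fK s t; wlog st : s t / s <= t.
  move=> H sac tac; have [st|/ltW ts] := leP s t; first exact: H.
  by rewrite distrC [`|t - s|]distrC; exact: H.
rewrite !in_itv/= => /andP[as_ sc] /andP[at_ tc].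
have [tb|/ltW bt] := leP t b.
  apply: (le_trans (fL _ _ _ _)); rewrite ?in_itv/= ?at_ ?as_ ?(le_trans st)//.
  by rewrite ler_wpM2r// lerDl.
have [bs|/ltW sb] := leP b s.
  apply: (le_trans (fK _ _ _ _)); rewrite ?in_itv/= ?bs ?bt ?sc ?tc//.
  by rewrite ler_wpM2r// lerDr.
have sb' : `|f b - f s| <= L * `|b - s|.
  by apply: fL; rewrite in_itv/= ?as_ ?lexx ?sb// andbT (le_trans as_).
have bt' : `|f t - f b| <= K * `|t - b|.
  by apply: fK; rewrite in_itv/= ?tc ?lexx ?bt ?(le_trans bt).
rewrite -[f t](subrK (f b)) -addrA (le_trans (ler_normD _ _))//.
rewrite (le_trans (lerD bt' sb'))// !ger0_norm ?subr_ge0//.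
by nra.
Qed.

End lipschitz.

(** * The vector-valued integral, coordinate by coordinate *)

Section vintegral_theory.
Context {R : realType} {d : nat} (N : vnorm R d).
Local Notation mu := (@completed_lebesgue_measure R).
Implicit Types (a b : R) (u v : R -> Rd N).

(** [K] is chosen before the interval, the function and its bound. This uniformity is what later
    yields an operator bound independent of [u]. *)
Lemma vintegral_lipschitz : exists2 K : R, 0 <= K &
  forall a b u M, is_Binf a b u -> 0 <= M ->
    (forall t, t \in `[a, b] -> `|u t| <= M) ->
    lipschitz_itv a b (K * M) (fun t => vintegral a t u).
Proof.
have [K K0 coordK] := coord_le_vnorm N.
(* The factor [K] passes from [N] to coordinates, the sum returns from coordinates to [N]. *)
exists (K * \sum_(i < d) N 'e_i).
  by rewrite mulr_ge0// sumr_ge0// => i _; exact: vnorm_ge0.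
move=> a b u M [_ mu_ _] M0 uM s t abs abt.
rewrite (le_trans (vnorm_coord N _))//.
have -> : K * (\sum_(i < d) N 'e_i) * M * `|t - s| =
    \sum_(i < d) K * M * `|t - s| * N 'e_i by rewrite -mulr_sumr; ring.
apply: ler_sum => i _; rewrite !mxE.
have uKM x : x \in `[a, b] -> `|(u x : 'rV[R]_d) 0 i| <= K * M.
  by move=> /uM xM; rewrite (le_trans (coordK _ _))// ler_wpM2l.
have := lebesgue_primitive_lip (mu_ i) uKM (mulr_ge0 K0 M0) abs abt.
by move=> ?; rewrite ler_wpM2r ?vnorm_ge0.
Qed.

Lemma Binf_coord_bounded a b u : is_Binf a b u ->
  exists2 M : R, 0 <= M &
    forall i t, t \in `[a, b] -> `|(u t : 'rV[R]_d) 0 i| <= M.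
Proof.
move=> [_ _ [M uM]]; have [K K0 coordK] := coord_le_vnorm N.
exists (K * `|M|); first by rewrite mulr_ge0.
move=> i t /uM tM; rewrite (le_trans (coordK _ _))// ler_wpM2l//.
by rewrite (le_trans tM)// ler_norm.
Qed.

(** Each coordinate has its own null set of bad points; the union of these finitely many sets is
    still null. *)
Lemma vintegral_deriv_ae a b u : is_Binf a b u ->
  {ae mu, forall t, t \in `[a, b[ ->
    has_right_deriv (fun t => vintegral a t u) t (u t)}.
Proof.
move=> Bu; have [M M0 uM] := Binf_coord_bounded Bu; have [_ mu_ _] := Bu.
have aeF := ae_filter_ringOfSetsType mu.
have : {ae mu, forall t (i : 'I_d), t \in `[a, b[ ->
  h^-1 * (\int[mu]_(s in `[a, t + h]) (u s : 'rV[R]_d) 0 i -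
          \int[mu]_(s in `[a, t]) (u s : 'rV[R]_d) 0 i)
    @[h --> 0^'+] --> (u t : 'rV[R]_d) 0 i}.
  apply: filter_forall => i.
  exact: lebesgue_primitive_deriv_ae (mu_ i) (uM i) M0.
apply: filterS => t tu abt; apply: Rd_cvg_coord => i.
have := tu i abt; rewrite (_ : (fun h : R => _ * _) = (fun h => (h^-1 *:
  (vintegral a (t + h) u - vintegral a t u : Rd N) : 'rV[R]_d) 0 i))//.
by apply/funext => h; rewrite !mxE.
Qed.

Lemma vintegral_point a b u : is_Binf a b u -> a <= b -> vintegral a a u = 0.
Proof.
move=> Bu ab; have [M M0 uM] := Binf_coord_bounded Bu; have [_ mu_ _] := Bu.
apply/rowP => i; rewrite !mxE.
exact: lebesgue_primitive0 (mu_ i) (uM i) M0 ab.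
Qed.

Lemma vintegralP a b t (l : R) u v : is_Binf a b u -> is_Binf a b v ->
  t \in `[a, b] ->
  vintegral a t (l *: u + v) = l *: vintegral a t u + vintegral a t v.
Proof.
move=> Bu Bv abt; have [M _ uM] := Binf_coord_bounded Bu.
have [K _ vK] := Binf_coord_bounded Bv.
have [[_ mu_ _] [_ mv _]] := (Bu, Bv).
apply/rowP => i; rewrite !mxE.
have iu := lebesgue_integrable_itv (mu_ i) (uM i) abt.
have iv := lebesgue_integrable_itv (mv i) (vK i) abt.
have mat : measurable (`[a, t] : set (lebesgueR R)) by exact: borel_lebesgue.
rewrite -RintegralZl// -RintegralD//; last exact: (integrableZl mat l iu).
by apply: eq_Rintegral => s _; rewrite !mxE.
Qed.

End vintegral_theory.

(** * The continuation operator for general endpoints *)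

Section continuation.
Context {R : realType} {d : nat} (N : vnorm R d) (a b c : R).
Hypotheses (ab : a <= b) (bc : b <= c).
Local Notation mu := (@completed_lebesgue_measure R).
Implicit Types (u : Binf N b c) (psi : B1inf N a b).

(** The second branch also covers points outside [[a, c]], where [psi] is 0, so the result is again
    supported in [[a, c]]. *)
Definition continuation u psi (t : R) : Rd N :=
  if t \in `[b, c] then psi b + vintegral b t u else psi t.

(** At [b] the values of [u] and of the derivative of [psi] may differ; [u] takes precedence, in
    line with derivatives from the right. *)
Definition continuation_deriv u psi (t : R) : Rd N :=
  if t \in `[b, c] then u t else B1inf_deriv psi t.

(** The two branches meet only at [b], where the integral is over a single point and vanishes. *)
Lemma continuationE_left u psi t :
  t \in `[a, b] -> continuation u psi t = psi t.
Proof.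
rewrite /continuation in_itv/= => /andP[_ tb]; case: ifPn => //.
rewrite in_itv/= => /andP[bt _].
have -> : t = b by apply/eqP; rewrite eq_le tb bt.
by rewrite (vintegral_point (BinfP u) bc) addr0.
Qed.

Lemma in_itv_continuation t :
  t \in `[a, c] -> (t \in `[a, b]) || (t \in `[b, c]).
Proof.
by rewrite !in_itv/= => /andP[-> ->]; rewrite andbT; exact: le_total.
Qed.

Lemma notin_itv_continuation t :
  t \notin `[a, c] -> t \notin `[a, b] /\ t \notin `[b, c].
Proof.
move=> tac; split; apply: contra tac; rewrite !in_itv/= => /andP[].
  by move=> -> /le_trans->.
by move=> /(le_trans ab)->.
Qed.

Lemma continuation_supported u psi : supported a c (continuation u psi).
Proof.
have [spsi _ _ _ _] := B1infP psi.
move=> t /notin_itv_continuation[tab tbc].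
by rewrite /continuation (negbTE tbc); exact: spsi.
Qed.

Lemma continuation_deriv_supported u psi :
  supported a c (continuation_deriv u psi).
Proof.
have [_ _ [sdpsi _ _] _ _] := B1infP psi.
move=> t /notin_itv_continuation[tab tbc].
by rewrite /continuation_deriv (negbTE tbc); exact: sdpsi.
Qed.

Lemma continuation_deriv_Binf u psi : is_Binf a c (continuation_deriv u psi).
Proof.
split; first exact: continuation_deriv_supported.
- move=> i; have [_ mu_ _] := BinfP u; have [_ _ [_ mpsi _] _ _] := B1infP psi.
  have mI (x y : R) : measurable (`[x, y] : set (lebesgueR R)).
    exact: borel_lebesgue.
  rewrite (_ : (fun _ => _) = (fun t : lebesgueR R => if t \in `[b, c] then
    (u t : 'rV[R]_d) 0 i else (B1inf_deriv psi t : 'rV[R]_d) 0 i)); last first.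
    by apply/funext => t; rewrite /continuation_deriv; case: ifP.
  apply: (measurable_fun_if (mI a c)).
  + apply: (measurable_fun_bool true).
    rewrite (_ : _ `&` _ = `[a, c] `&` `[b, c])//.
    exact: measurableI (mI a c) (mI b c).
  + by apply: (measurable_funS (mI b c)) (mu_ i) => t [].
  + apply: (measurable_funS (mI a b)) (mpsi i) => t /= [/in_itv_continuation].
    by move=> /orP[//|->].
- have [M uM] := Binf_bounded u; have [K dK] := B1inf_deriv_bounded psi.
  exists (Num.max M K) => t /in_itv_continuation tac.
  rewrite /continuation_deriv; case: ifPn tac => [tbc _|_].
    by rewrite le_max uM.
  by rewrite orbF => tab; rewrite le_max dK ?orbT.
Qed.

Lemma continuation_lipschitz u psi :
  exists L, lipschitz_itv a c L (continuation u psi).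
Proof.
have [K K0 Klip] := vintegral_lipschitz N.
have [M uM] := Binf_bounded u.
have [_ _ _ _ [L psiL]] := B1infP psi.
(* Absolute values supply the non-negative constants that gluing asks for. *)
exists (`|L| + K * `|M|); apply: (@lipschitz_itv_glue _ _ a b c).
- exact: normr_ge0.
- by rewrite mulr_ge0.
- move=> s t sab tab; rewrite !continuationE_left//.
  by rewrite (le_trans (psiL s t sab tab))// ?ler_wpM2r// ler_norm.
- move=> s t sbc tbc; rewrite /continuation sbc tbc opprD addrACA subrr add0r.
  apply: (Klip _ _ _ _ (BinfP u)) => // x /uM xM.
  by rewrite (le_trans xM)// ler_norm.
Qed.

(** A right derivative at [t] depends only on points just to the right of [t]: these stay in
    [[a, b]] when [t < b] and in [[b, c]] when [b <= t < c], so the junction causes no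
    difficulty. *)
Lemma continuation_deriv_ae u psi : {ae mu, forall t, t \in `[a, c[ ->
  has_right_deriv (continuation u psi) t (continuation_deriv u psi t)}.
Proof.
have [_ _ _ dpsi _] := B1infP psi.
have aeF := ae_filter_ringOfSetsType mu.
apply: filterS2 dpsi (vintegral_deriv_ae (BinfP u)) => t psit ut.
rewrite in_itv/= => /andP[at_ tc].
have [tb|bt] := ltP t b.
- have tab : t \in `[a, b[ by rewrite in_itv/= at_.
  have tab' : t \in `[a, b] by rewrite in_itv/= at_ ltW.
  rewrite /continuation_deriv ifN; last by rewrite in_itv/= leNgt tb.
  apply: cvg_trans (psit tab); apply: near_eq_cvg; near=> h.
  rewrite !continuationE_left// in_itv/=; apply/andP; split.
    by rewrite (le_trans at_)// lerDl; near: h; exact: nbhs_right_ge.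
  by rewrite -lerBrDl; near: h; apply: nbhs_right_le; rewrite subr_gt0.
- have tbc : t \in `[b, c[ by rewrite in_itv/= bt.
  have tbc' : t \in `[b, c] by rewrite in_itv/= bt ltW.
  rewrite /continuation_deriv tbc'.
  apply: cvg_trans (ut tbc); apply: near_eq_cvg; near=> h.
  have thbc : t + h \in `[b, c].
    rewrite in_itv/=; apply/andP; split.
      by rewrite (le_trans bt)// lerDl; near: h; exact: nbhs_right_ge.
    by rewrite -lerBrDl; near: h; apply: nbhs_right_le; rewrite subr_gt0.
  by rewrite /continuation thbc tbc' opprD addrACA subrr add0r.
Unshelve. all: by end_near. Qed.

Lemma continuation_B1inf u psi :
  is_B1inf a c (continuation u psi, continuation_deriv u psi).
Proof.
have [L fL] := continuation_lipschitz u psi.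
split => /=; [exact: continuation_supported|exact: lipschitz_itv_continuous fL|
  exact: continuation_deriv_Binf|exact: continuation_deriv_ae|by exists L].
Qed.

Definition continuation_op (x : (Binf N b c * B1inf N a b)%type) :
    B1inf N a c :=
  MkB1inf (asboolT (continuation_B1inf x.1 x.2)).

Lemma continuation_op_linear : linear continuation_op.
Proof.
move=> l [u psi] [v phi]; apply: val_inj => /=; congr pair; apply/funext => t.
- rewrite -[RHS]/(l *: continuation u psi t + continuation v phi t).
  rewrite /continuation; case: ifP => // tbc.
  rewrite -[B1inf_fun _ b]/(l *: psi b + phi b).
  rewrite (_ : Binf_fun _ = l *: (u : R -> Rd N) + v)//.
  rewrite (vintegralP l (BinfP u) (BinfP v) tbc).
  by rewrite scalerDr addrACA.
- rewrite -[RHS]/(l *: continuation_deriv u psi t + continuation_deriv v phi t).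
  by rewrite /continuation_deriv; case: ifP.
Qed.

HB.instance Definition _ := GRing.isLinear.Build R _ _ _ continuation_op
  continuation_op_linear.

Lemma continuation_op_bounded : bounded_operator continuation_op.
Proof.
have [K K0 Klip] := vintegral_lipschitz N.
(* The part [1 + K * (c - b)] bounds the function, through [psi b] plus the integral over a length
   of at most [c - b]. The 2 covers the derivative, which is bounded by the larger of the two input
   norms. *)
exists (2 + (1 + K * (c - b))) => -[u psi]; rewrite prod_normE /=.
set m := Num.max _ _.
have um : supnorm b c u <= m by rewrite /m le_max lexx.
have psim : supnorm a b psi + supnorm a b (B1inf_deriv psi) <= m.
  by rewrite /m le_max lexx orbT.
have := supnorm_ge0 a b psi; have := supnorm_ge0 a b (B1inf_deriv psi).
have := supnorm_ge0 b c u => u0 dpsi0 psi0.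
have m0 : 0 <= m by lra.
have cb : 0 <= c - b by rewrite subr_ge0.
have bbc : b \in `[b, c] by rewrite in_itv/= lexx.
have bab : b \in `[a, b] by rewrite in_itv/= lexx ab.
rewrite [2 + _]addrC mulrDl.
apply: lerD; apply: supnorm_le => [|t tac].
- by rewrite mulr_ge0// addr_ge0// mulr_ge0.
- rewrite /B1inf_fun /=.
  have [/andP[_ tab]|] := boolP ((t \notin `[b, c]) && (t \in `[a, b])).
    rewrite continuationE_left//.
    rewrite (le_trans (supnorm_ge (B1inf_bounded psi) tab))//.
    rewrite (@le_trans _ _ m)//; first by lra.
    by rewrite ler_peMl// lerDl mulr_ge0.
  rewrite negb_and negbK => tN.
  have tbc : t \in `[b, c].
    by case/orP: tN (in_itv_continuation tac) => // /negbTE ->.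
  rewrite /continuation tbc (le_trans (ler_normD _ _))// mulrDl mul1r lerD//.
    by rewrite (le_trans (supnorm_ge (B1inf_bounded psi) bab))//; lra.
  have uM x : x \in `[b, c] -> `|u x| <= supnorm b c u.
    exact: supnorm_ge (Binf_bounded u).
  (* The integral vanishes at [b], so its Lipschitz estimate between [b] and [t] bounds its size. *)
  have := Klip _ _ _ _ (BinfP u) u0 uM _ _ bbc tbc.
  rewrite (vintegral_point (BinfP u) bc) subr0 => /le_trans; apply.
  rewrite -mulrA -mulrA ler_wpM2l// mulrC.
  move: tbc; rewrite in_itv/= => /andP[bt tc].
  by rewrite ler_pM// ger0_norm ?subr_ge0// lerB.
- by rewrite mulr_ge0.
- rewrite /B1inf_deriv /= /continuation_deriv; case: ifPn => [tbc|tNbc].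
    by rewrite (le_trans (supnorm_ge (Binf_bounded u) tbc))//; lra.
  have tab : t \in `[a, b].
    by move: (in_itv_continuation tac); rewrite (negbTE tNbc) orbF.
  by rewrite (le_trans (supnorm_ge (B1inf_deriv_bounded psi) tab))//; lra.
Qed.

End continuation.

(* Specialisation to the endpoints -1, 0 and 1 *)
Local Close Scope classical_set_scope.

Theorem proposition2p2 (R : realType) (d : nat) (d_gt0 : (0 < d)%N)
    (N : vnorm R d) :
  exists G : {linear (Binf N 0 1 * B1inf N (-1) 0)%type -> B1inf N (-1) 1},
    [/\ forall (u : Binf N 0 1) (psi : B1inf N (-1) 0) (t : R),
          t \in `[0, 1] -> G (u, psi) t = psi 0 + vintegral 0 t u,
        forall (u : Binf N 0 1) (psi : B1inf N (-1) 0) (t : R),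
          t \in `[-1, 0] -> G (u, psi) t = psi t,
        forall (u : Binf N 0 1) (psi : B1inf N (-1) 0) (t : R),
          t \in `[0, 1] -> B1inf_deriv (G (u, psi)) t = u t,
        forall (u : Binf N 0 1) (psi : B1inf N (-1) 0) (t : R),
          t \in `[-1, 0[ -> B1inf_deriv (G (u, psi)) t = B1inf_deriv psi t &
        bounded_operator G].
Proof.
have N10 : -1 <= 0 :> R by rewrite lerN10.
exists (continuation_op N10 ler01); split.
- by move=> u psi t tI; rewrite /B1inf_fun /= /continuation tI.
- by move=> u psi t tI; rewrite -(continuationE_left ler01 u psi tI).
- by move=> u psi t tI; rewrite /B1inf_deriv /= /continuation_deriv tI.
- move=> u psi t; rewrite in_itv/= => /andP[_ t0].
  by rewrite /B1inf_deriv /= /continuation_deriv ifN// in_itv/= leNgt t0.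
- exact: continuation_op_bounded.
Qed.
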